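(* Let $k$ be an algebraically closed field and let $s_1,\dots,s_m$ be a finite set of formal branches of curves centered at infinity in $\mathbb{A}^2_k=\mathrm{Spec}\,k[x,y]$. Then there exists a nonzero polynomial $P\in k[x,y]$ such that $\mathrm{ord}_\infty(P|_{s_i})>0$ for all $i=1,\dots,m$.
   Context: A formal branch of curve centered at infinity is an irreducible formal curve germ $s$ at a point of the line at infinity $L_\infty=\mathbb{P}^2_k\setminus\mathbb{A}^2_k$, not contained in $L_\infty$; equivalently it is given by a primitive parametrization $(x(\tau),y(\tau))\in k((\tau))^2$ with $\min\{\mathrm{ord}_\tau x(\tau),\mathrm{ord}_\tau y(\tau)\}<0$. One sets $\mathrm{ord}_\infty(P|_s)=\mathrm{ord}_\tau P(x(\tau),y(\tau))\in\mathbb{Z}\cup\{+\infty\}$. *)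

(* Defs.v *)
From HB Require Import structures.
From mathcomp Require Import all_boot all_order all_algebra.
(* [mpoly] must be loaded before [constructive_ereal]: their notations have
   conflicting levels in the other order. *)
From mathcomp Require Import mpoly boolp constructive_ereal.

Set Implicit Arguments.
Unset Strict Implicit.
Unset Printing Implicit Defensive.

Import Order.TTheory GRing.Theory Num.Theory.
Local Open Scope quotient_scope.
Local Open Scope ring_scope.

(** * The ring k[[t]] *)

Record fps (k : fieldType) := Fps { fps_coef :> nat -> k }.

Lemma fpsP (k : fieldType) (f g : fps k) : (forall n, f n = g n) -> f = g.
Proof. by case: f g => [f] [g] /= /funext ->. Qed.

HB.instance Definition _ (k : fieldType) := gen_eqMixin (fps k).
HB.instance Definition _ (k : fieldType) := gen_choiceMixin (fps k).

Section FpsZmod.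
Variable k : fieldType.
Implicit Types f g h : fps k.

Definition fps_zero : fps k := Fps (fun=> 0).
Definition fps_opp f : fps k := Fps (fun n => - f n).
Definition fps_add f g : fps k := Fps (fun n => f n + g n).

Lemma fps_addA : associative fps_add.
Proof. by move=> f g h; apply: fpsP => n /=; rewrite addrA. Qed.
Lemma fps_addC : commutative fps_add.
Proof. by move=> f g; apply: fpsP => n /=; rewrite addrC. Qed.
Lemma fps_add0 : left_id fps_zero fps_add.
Proof. by move=> f; apply: fpsP => n /=; rewrite add0r. Qed.
Lemma fps_addN : left_inverse fps_zero fps_opp fps_add.
Proof. by move=> f; apply: fpsP => n /=; rewrite addNr. Qed.

HB.instance Definition _ :=
  GRing.isZmodule.Build (fps k) fps_addA fps_addC fps_add0 fps_addN.

Lemma fps0E n : (0 : fps k) n = 0. Proof. by []. Qed.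
Lemma fpsNE f n : (- f) n = - f n. Proof. by []. Qed.
Lemma fpsDE f g n : (f + g) n = f n + g n. Proof. by []. Qed.

End FpsZmod.

Section FpsRing.
Variable k : fieldType.
Implicit Types f g h : fps k.

Definition fpsC (c : k) : fps k := Fps (fun n => if n is 0%N then c else 0).
Definition fps_mul f g : fps k :=
  Fps (fun n => \sum_(i < n.+1) f i * g (n - i)%N).

Definition fps_trunc (N : nat) f : {poly k} := \poly_(i < N) f i.

Lemma fps_mul_trunc f g N n : (n < N)%N ->
  fps_mul f g n = (fps_trunc N f * fps_trunc N g)`_n.
Proof.
move=> nN; rewrite coefM /=; apply: eq_bigr => i _; rewrite !coef_poly.
by rewrite (leq_ltn_trans (leq_subr _ _) nN) (leq_ltn_trans _ nN) // -ltnS.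
Qed.

Lemma fps_mulC : commutative fps_mul.
Proof.
by move=> f g; apply: fpsP => n; rewrite !(@fps_mul_trunc _ _ n.+1) // mulrC.
Qed.

Lemma fps_mulA : associative fps_mul.
Proof.
move=> f g h; apply: fpsP => n; rewrite !(@fps_mul_trunc _ _ n.+1) //.
have T u i : (i < n.+1)%N -> (fps_trunc n.+1 u)`_i = u i.
  by move=> lti; rewrite coef_poly lti.
transitivity ((fps_trunc n.+1 f * (fps_trunc n.+1 g * fps_trunc n.+1 h))`_n).
  rewrite !coefM; apply: eq_bigr => i _; congr (_ * _).
  by rewrite T ?(@fps_mul_trunc _ _ n.+1) // ltnS leq_subr.
rewrite mulrA !coefM; apply: eq_bigr => i _; congr (_ * _).
by rewrite T ?(@fps_mul_trunc _ _ n.+1).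
Qed.

Lemma fps_mul1 : left_id (fpsC 1) fps_mul.
Proof.
move=> f; apply: fpsP => n /=; rewrite big_ord_recl /= mul1r subn0 big1 ?addr0//.
by move=> i _; rewrite mul0r.
Qed.

Lemma fps_mulDl : left_distributive fps_mul +%R.
Proof.
move=> f g h; apply: fpsP => n /=; rewrite -big_split /=.
by apply: eq_bigr => i _; rewrite mulrDl.
Qed.

Lemma fps_1neq0 : fpsC 1 != 0.
Proof.
by apply/eqP => /(congr1 (fun f => fps_coef f 0)) /eqP; rewrite oner_eq0.
Qed.

HB.instance Definition _ := GRing.Zmodule_isComNzRing.Build (fps k)
  fps_mulA fps_mulC fps_mul1 fps_mulDl fps_1neq0.

Lemma fpsME f g n : (f * g) n = \sum_(i < n.+1) f i * g (n - i)%N.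
Proof. by []. Qed.

Definition fps_unit : {pred fps k} := fun f => `[< exists g, g * f = 1 >].
Definition fps_inv f : fps k :=
  if pselect (exists g, g * f = 1) is left ex then projT1 (cid ex) else f.

Lemma fps_mulV : {in fps_unit, left_inverse 1 fps_inv *%R}.
Proof.
move=> f /asboolP uf; rewrite /fps_inv; case: pselect => // ex.
by case: (cid ex).
Qed.
Lemma fps_unitP f g : g * f = 1 -> fps_unit f.
Proof. by move=> gf1; apply/asboolP; exists g. Qed.
Lemma fps_inv_out : {in [predC fps_unit], fps_inv =1 id}.
Proof.
move=> f /asboolPn nuf; rewrite /fps_inv; case: pselect => //.
Qed.

HB.instance Definition _ := GRing.ComNzRing_hasMulInverse.Build (fps k)
  fps_mulV fps_unitP fps_inv_out.

(* [f] has lowest nonzero coefficient in degree [n] *)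
Definition fps_lowest f n := f n != 0 /\ forall i, (i < n)%N -> f i = 0.

Lemma fps_neq0_lowest f : f != 0 -> exists n, fps_lowest f n.
Proof.
move=> f0; have ex : exists n, f n != 0.
  apply: contrapT => H; case/eqP: f0; apply: fpsP => n; apply/eqP.
  by apply: contra_notT H => fn; exists n.
exists (ex_minn ex); case: ex_minnP => n fn min; split=> // i ltin.
by apply/eqP; apply: contraTT ltin => /min; rewrite -leqNgt.
Qed.

Lemma fps_lowestM f g m n :
  fps_lowest f m -> fps_lowest g n -> fps_lowest (f * g) (m + n).
Proof.
move=> [fm f_lt] [gn g_lt]; split.
  rewrite fpsME (bigD1 (Ordinal (leq_addr n m : (m < (m + n).+1)%N))) //=.
  rewrite addKn big1 ?addr0 ?mulf_neq0 // => i; rewrite -val_eqE /= => neq_im.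
  case: (ltngtP i m) neq_im => // [lt_im|lt_mi] _; first by rewrite f_lt ?mul0r.
  by rewrite g_lt ?mulr0 // ltn_subLR ?ltn_add2r // -ltnS.
move=> j ltj; rewrite fpsME big1 // => i _.
case: (ltnP i m) => [lt_im|le_mi]; first by rewrite f_lt ?mul0r.
rewrite g_lt ?mulr0 // ltn_subLR; last by rewrite -ltnS.
by rewrite (leq_trans ltj) // leq_add2r.
Qed.

Lemma fps_integral f g : f * g = 0 -> (f == 0) || (g == 0).
Proof.
move=> fg0; apply/orP; case: (eqVneq f 0) => [|f0]; [by left | right].
apply: contra_eqT fg0 => g0.
have [m fm] := fps_neq0_lowest f0; have [n gn] := fps_neq0_lowest g0.
have [+ _] := fps_lowestM fm gn.
by apply: contraNneq => ->.
Qed.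

HB.instance Definition _ :=
  GRing.ComUnitRing_isIntegral.Build (fps k) fps_integral.

Lemma fpsC_zmod_morphism : zmod_morphism fpsC.
Proof.
by move=> a b; apply: fpsP => -[|n] /=; rewrite ?fpsDE ?fpsNE /= ?subr0.
Qed.
Lemma fpsC_monoid_morphism : monoid_morphism fpsC.
Proof.
split=> // a b; apply: fpsP => n; rewrite fpsME big_ord_recl big1 => [|i _].
  by case: n => [|n] /=; rewrite addr0 ?mulr0.
by rewrite /= mul0r.
Qed.
HB.instance Definition _ :=
  GRing.isZmodMorphism.Build k (fps k) fpsC fpsC_zmod_morphism.
HB.instance Definition _ :=
  GRing.isMonoidMorphism.Build k (fps k) fpsC fpsC_monoid_morphism.

(* The composite f(s(t)). This is meaningful only when s has zero constant
   term: then s^i has order at least i, so that only the terms i <= n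
   contribute to the coefficient of t^n. *)
Definition fps_comp f (s : fps k) : fps k :=
  Fps (fun n => \sum_(i < n.+1) f i * (s ^+ i) n).

Definition fps_ord f : \bar int :=
  if pselect (exists n, f n != 0) is left ex then (ex_minn ex)%:Z%:E else +oo%E.

Lemma fps_ord0 : fps_ord 0 = +oo%E.
Proof. by rewrite /fps_ord; case: pselect => // -[n]; rewrite eqxx. Qed.

Lemma fps_ord_lowest f n : fps_lowest f n -> fps_ord f = n%:Z%:E.
Proof.
move=> [fn f_lt]; rewrite /fps_ord; case: pselect => [ex|[]]; last by exists n.
case: ex_minnP => m fm min; congr (_%:Z%:E); apply/eqP.
by rewrite eqn_leq min //= leqNgt; apply: contra fm => /f_lt ->.
Qed.

End FpsRing.

(** * The field k((t)) and its order valuation *)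

Notation laurent k := {fraction (fps k)}.

Section Laurent.
Variable k : fieldType.
Implicit Types z : laurent k.

Definition laurentC (c : k) : laurent k := tofrac (fpsC c).

(* [ord_tau_div] shows that the value does not depend on the chosen
   representative. *)
Definition ord_tau z : \bar int :=
  (fps_ord \n_(repr z) - fps_ord \d_(repr z))%E.

Lemma tofrac_Ratio (f g : fps k) : g != 0 ->
  \pi_(laurent k) (Ratio f g) = tofrac f / tofrac g.
Proof.
move=> g0; apply: (canRL (mulfK _)); first by rewrite tofrac_eq0.
unlock tofrac; rewrite -[LHS]FracField.pi_mul; apply/eqmodP => /=.
rewrite FracField.equivfE /FracField.mulf.
by rewrite !numden_Ratio ?mulf_neq0 ?oner_neq0 // !mulr1 mulrC.
Qed.

Lemma ord_tau_div (f g : fps k) : g != 0 ->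
  ord_tau (tofrac f / tofrac g) = (fps_ord f - fps_ord g)%E.
Proof.
move=> g0; set z := _ / _; rewrite /ord_tau.
have d0 : \d_(repr z) != 0 by apply: denom_ratioP.
have zE : z = tofrac \n_(repr z) / tofrac \d_(repr z).
  rewrite -[LHS]reprK; move: (repr z) d0 => r d0.
  by rewrite -[r in LHS]Ratio_numden; apply: tofrac_Ratio.
have : f * \d_(repr z) = \n_(repr z) * g.
  apply/eqP; rewrite -tofrac_eq !tofracM -eqr_div ?tofrac_eq0 //.
  by rewrite -zE.
move: (\n_(repr z)) (\d_(repr z)) d0 => a b b0 {zE} E.
have [m gm] := fps_neq0_lowest g0; have [n bn] := fps_neq0_lowest b0.
rewrite (fps_ord_lowest gm) (fps_ord_lowest bn).
have [a0|a0] := eqVneq a 0.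
  move: E; rewrite a0 mul0r => /eqP; rewrite mulf_eq0 (negPf b0) orbF => /eqP ->.
  by rewrite fps_ord0.
have f0 : f != 0.
  by apply: contra_eq_neq E => ->; rewrite mul0r eq_sym mulf_neq0.
have [p fp] := fps_neq0_lowest f0; have [q aq] := fps_neq0_lowest a0.
rewrite (fps_ord_lowest fp) (fps_ord_lowest aq).
have := fps_ord_lowest (fps_lowestM fp bn).
rewrite E (fps_ord_lowest (fps_lowestM aq gm)) => -[] H.
rewrite -!EFinB; congr (_%:E).
by apply/eqP; rewrite subr_eq addrAC eq_sym subr_eq -!PoszD -H.
Qed.

(* [z] lies in the subfield k((s)) of k((t)), for a nonzero [s] without constant
   term: [z] is the substitution of [s] into the Laurent series T^-n g(T). *)
Definition in_laurent_of (s : fps k) z : Prop :=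
  exists (g : fps k) (n : nat), z = tofrac (fps_comp g s) / tofrac s ^+ n.

(* A parametrization is primitive when it does not factor through a
   substitution t |-> s(t) with ord s > 1. *)
Definition primitive_param (x y : laurent k) : Prop :=
  forall s : fps k, (0 < fps_ord s < +oo)%E ->
  in_laurent_of s x -> in_laurent_of s y -> fps_ord s = 1%E.

End Laurent.

(** * Branches at infinity of the affine plane *)

(* A branch is represented by any one of its primitive parametrizations; two
   of them differ by an automorphism of k[[t]], which preserves orders. *)
Record branch_at_infinity (k : fieldType) := BranchAtInfinity {
  branch_x : laurent k;
  branch_y : laurent k;
  branch_primitive : primitive_param branch_x branch_y;
  branch_pole : (Order.min (ord_tau branch_x) (ord_tau branch_y) < 0)%E
}.

Definition branch_coord (k : fieldType) (s : branch_at_infinity k) :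
    'I_2 -> laurent k :=
  fun i => if i == ord0 then branch_x s else branch_y s.

Definition ord_infty (k : fieldType) (P : {mpoly k[2]})
    (s : branch_at_infinity k) : \bar int :=
  ord_tau (mmap (@laurentC k) (branch_coord s) P).

(* Main.v *)
Require Import Defs.
From mathcomp Require Import all_boot all_order all_algebra.
From mathcomp Require Import mpoly boolp constructive_ereal.

(** The theorem is a count of dimensions.  Polynomials of degree less than [N] in
    each variable form a space of dimension [N ^ 2].  Along a fixed branch, the
    pole of such a polynomial has order at most linear in [N], so that asking
    for positive order amounts to [O(N)] linear equations on its coefficients,
    one for each coefficient of a nonpositive power of the parameter.  For
    finitely many branches this is still [O(N)] equations, and for large [N] a
    nonzero polynomial satisfies all of them.

    To stay among power series, write both coordinates of a branch over a common
    denominator, [x = a / c] and [y = b / c].  Multiplying [P(x, y)] by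
    [c ^ 2N] gives a power series whose coefficients are linear in those of [P]
    ([box_poly_fracE]), and [P(x, y)] has positive order as soon as these
    coefficients vanish up to degree [2N * ord c]
    ([ord_tau_div_gt0]).  The linear algebra is [underdetermined_system], and
    [exists_mpoly_ord_tau_gt0] is the resulting statement for arbitrary pairs of
    Laurent series. *)

Set Implicit Arguments.
Unset Strict Implicit.
Unset Printing Implicit Defensive.

Import Order.TTheory GRing.Theory Num.Theory.
Local Open Scope ring_scope.

(** The rank of the coefficient matrix is at most [#|J|], so its row kernel is
    nonzero.  Arbitrary finite index types spare the users from numbering
    unknowns and equations. *)
Lemma underdetermined_system (k : fieldType) (I J : finType) (A : I -> J -> k) :
  (#|J| < #|I|)%N ->
  exists v : I -> k,
    (exists i, v i != 0) /\ forall j, \sum_i v i * A i j = 0.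
Proof.
move=> ltJI.
pose M := \matrix_(i < #|I|, j < #|J|) A (enum_val i) (enum_val j).
have /rowV0Pn[u /sub_kermxP uM0 u0] : kermx M != 0.
  rewrite -mxrank_eq0 mxrank_ker subn_eq0 -ltnNge.
  exact: leq_ltn_trans (rank_leq_col M) ltJI.
exists (fun i => u ord0 (enum_rank i)); split.
  have /rV0Pn[i ui] := u0.
  by exists (enum_val i); rewrite enum_valK.
move=> j; have /rowP/(_ (enum_rank j)) := uM0; rewrite !mxE; apply: etrans.
rewrite (reindex (@enum_val I I)) /=; last by apply: onW_bij; apply: enum_val_bij.
by apply: eq_bigr => i _; rewrite !mxE enum_valK enum_rankK.
Qed.

Section PowerSeries.
Variable k : fieldType.
Implicit Types (f g a b c : fps k) (z : laurent k).

Lemma fps_sumE (I : finType) (F : I -> fps k) n :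
  (\sum_i F i) n = \sum_i F i n.
Proof. by elim/big_rec2: _ => // i u v _ <-. Qed.

Lemma fpsCME (u : k) f n : (fpsC u * f) n = u * f n.
Proof.
by rewrite fpsME big_ord_recl /= subn0 big1 ?addr0 // => i _; rewrite mul0r.
Qed.

Lemma fps_lowestX f n e : fps_lowest f n -> fps_lowest (f ^+ e) (e * n).
Proof.
move=> fn; elim: e => [|e IHe]; first by split; rewrite ?oner_neq0.
by rewrite exprS mulSn; apply: fps_lowestM.
Qed.

Lemma ord_tau_div_gt0 f g n :
  fps_lowest g n -> (forall i, (i <= n)%N -> f i = 0) ->
  (0 < ord_tau (tofrac f / tofrac g)%R)%E.
Proof.
move=> gn f_le; have g0 : g != 0 by apply: contraNneq gn.1 => ->.
rewrite ord_tau_div // (fps_ord_lowest gn).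
have [->|f0] := eqVneq f 0; first by rewrite fps_ord0.
have [l fl] := fps_neq0_lowest f0.
rewrite (fps_ord_lowest fl) -EFinB lte_fin subr_gt0 ltz_nat ltnNge.
by apply: contraNN fl.1 => /f_le ->.
Qed.

Lemma laurent_fracP z : exists f g, g != 0 /\ z = tofrac f / tofrac g.
Proof.
exists \n_(repr z), \d_(repr z); split; first exact: denom_ratioP.
by rewrite -tofrac_Ratio ?denom_ratioP // Ratio_numden reprK.
Qed.

Lemma laurent_common_denominator (x y : laurent k) :
  exists a b c,
    [/\ c != 0, x = tofrac a / tofrac c & y = tofrac b / tofrac c].
Proof.
have [a [c [c0 ->]]] := laurent_fracP x.
have [b [d [d0 ->]]] := laurent_fracP y.
exists (a * d), (b * c), (c * d); rewrite mulf_neq0 // !tofracM; split=> //.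
  by rewrite -mulf_div divff ?mulr1 // tofrac_eq0.
by rewrite [tofrac c * _]mulrC -mulf_div divff ?mulr1 // tofrac_eq0.
Qed.

End PowerSeries.

Section BoxPolynomials.
Variables (k : fieldType) (N : nat).
Implicit Types (v : 'I_N * 'I_N -> k) (p : 'I_N * 'I_N).

Definition box_monom p : 'X_{1..2} := [multinom of [:: p.1 : nat; p.2 : nat]].

Definition box_poly v : {mpoly k[2]} := \sum_p v p *: 'X_[box_monom p].

Lemma box_monom_inj : injective box_monom.
Proof.
move=> [i j] [i' j'] /(congr1 val)/(congr1 val) /= [? ?].
by congr pair; apply: val_inj.
Qed.

Lemma mcoeff_box_poly v p : (box_poly v)@_(box_monom p) = v p.
Proof.
rewrite /box_poly raddf_sum (bigD1 p) //= mcoeffZ mcoeffX eqxx mulr1.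
rewrite big1 ?addr0 // => q neq_qp.
by rewrite mcoeffZ mcoeffX (inj_eq box_monom_inj) (negPf neq_qp) mulr0.
Qed.

Lemma mmap_box_poly v (h : 'I_2 -> laurent k) :
  mmap (@laurentC k) h (box_poly v) =
    \sum_p laurentC (v p) * (h ord0 ^+ p.1 * h ord_max ^+ p.2).
Proof.
(* [laurentC] is this composite of ring morphisms, so that [mmap] is linear. *)
rewrite -[@laurentC k]/(@tofrac (fps k) \o @fpsC k) raddf_sum /=.
apply: eq_bigr => p _; rewrite mmapZ mmapX /mmap1 !big_ord_recl big_ord0 mulr1.
by congr (_ * (_ * h _ ^+ _)); apply: val_inj.
Qed.

(** This is [c ^ 2N * x ^ p.1 * y ^ p.2] at [x = a / c], [y = b / c]; giving
    each variable its own factor [c ^ N] makes it a power series for every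
    monomial of the box. *)
Definition cleared_monom (a b c : fps k) p : fps k :=
  a ^+ p.1 * c ^+ (N - p.1) * (b ^+ p.2 * c ^+ (N - p.2)).

Lemma box_poly_fracE v (h : 'I_2 -> laurent k) (a b c : fps k) :
    c != 0 -> h ord0 = tofrac a / tofrac c -> h ord_max = tofrac b / tofrac c ->
  mmap (@laurentC k) h (box_poly v) =
    tofrac (\sum_p fpsC (v p) * cleared_monom a b c p) / tofrac (c ^+ (2 * N)).
Proof.
move=> c0 hx hy; rewrite mmap_box_poly raddf_sum mulr_suml.
have frac_expr (f : fps k) (i : 'I_N) :
    (tofrac f / tofrac c) ^+ i =
    tofrac (f ^+ i * c ^+ (N - i)) / tofrac (c ^+ N).
  have -> : c ^+ N = c ^+ i * c ^+ (N - i) by rewrite -exprD subnKC // ltnW.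
  rewrite !tofracM -mulf_div divff.
    by rewrite mulr1 expr_div_n !tofracXn.
  by rewrite tofrac_eq0 expf_neq0.
apply: eq_bigr => p _; rewrite hx hy !frac_expr mulf_div -!tofracM.
by rewrite mulrA -tofracM -exprD addnn -mul2n.
Qed.

End BoxPolynomials.

Theorem exists_mpoly_ord_tau_gt0 (k : fieldType) (m : nat)
    (h : 'I_m -> 'I_2 -> laurent k) :
  exists P : {mpoly k[2]},
    P != 0 /\ forall i, (0 < ord_tau (mmap (@laurentC k) (h i) P))%E.
Proof.
have abc_ex i : exists abc : fps k * fps k * fps k * nat,
    let: (a, b, c, n) := abc in
    [/\ fps_lowest c n, c != 0,
        h i ord0 = tofrac a / tofrac c & h i ord_max = tofrac b / tofrac c].
  have [a [b [c [c0 hx hy]]]] :=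
    laurent_common_denominator (h i ord0) (h i ord_max).
  by have [n cn] := fps_neq0_lowest c0; exists (a, b, c, n).
have [abc abcP] := choice abc_ex.
pose D := \max_i (abc i).2.
(* Each branch imposes [2 * N * D + 1] equations, at most [N * (2 * D + 1)];
   this [N] makes the total over the [m] branches less than [N * N]. *)
pose N := (m * (2 * D + 1)).+1.
pose A (p : 'I_N * 'I_N) (q : 'I_m * 'I_(2 * N * D).+1) : k :=
  cleared_monom (abc q.1).1.1.1 (abc q.1).1.1.2 (abc q.1).1.2 p q.2.
have card_lt : (#|{: 'I_m * 'I_(2 * N * D).+1}| < #|{: 'I_N * 'I_N}|)%N.
  rewrite !card_prod !card_ord.
  apply: (@leq_ltn_trans (N * (m * (2 * D + 1)))%N); last by rewrite ltn_pmul2l.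
  rewrite mulnCA leq_mul2l mulnDr muln1 mulnA [(N * 2)%N]mulnC -addn1.
  by rewrite leq_add2l orbT.
have [v [[p vp] vA]] := underdetermined_system A card_lt.
exists (box_poly v); split.
  by apply: contraNneq vp => P0; rewrite -(mcoeff_box_poly v) P0 mcoeff0.
move=> i; move: (abcP i) (erefl (abc i)).
case: {1 2}(abc i) => [[[a b] c] n] [cn c0 hx hy] abci.
rewrite (box_poly_fracE v c0 hx hy).
apply: ord_tau_div_gt0 (fps_lowestX (2 * N) cn) _ => l le_l.
have le_lD : (l < (2 * N * D).+1)%N.
  rewrite ltnS (leq_trans le_l) // leq_mul2l; apply/orP; right.
  by have := leq_bigmax (F := fun i => (abc i).2) i; rewrite -abci.
rewrite fps_sumE -[RHS](vA (i, Ordinal le_lD)).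
by apply: eq_bigr => q _; rewrite fpsCME /A /= -abci.
Qed.

Theorem corollary1p4 (k : closedFieldType) (m : nat)
    (s : 'I_m -> branch_at_infinity k) :
  exists P : {mpoly k[2]},
    P != 0 /\ forall i : 'I_m, (0 < ord_infty P (s i))%E.
Proof. exact: exists_mpoly_ord_tau_gt0 (fun i => branch_coord (s i)). Qed.
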